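(* Let $K$ be a subfield of $\mathbb{R}$ and let $\mathcal{K}$ be a definably complete expansion of the ordered field $K$. Then $\mathcal{K}$ is definably Baire; that is, there is no set $Y\subseteq K\times K_{>0}$ definable in $\mathcal{K}$ such that (i) $Y_t$ is nowhere dense in $K$ for all $t\in K_{>0}$, (ii) $Y_s\subseteq Y_t$ for all $s,t\in K_{>0}$ with $s<t$, and (iii) $\bigcup_{t\in K_{>0}}Y_t=K$.
   Context: An expansion $\mathcal{K}$ of $K$ is definably complete if every bounded subset of $K$ definable in $\mathcal{K}$ (with parameters) has a supremum in $K$. For $Y\subseteq K^2$ and $t\in K$, $Y_t=\{b\in K:(b,t)\in Y\}$. Nowhere dense refers to the order topology on $K$. *)

(* Defs.v *)
From HB Require Import structures.
From mathcomp Require Import all_boot all_order all_algebra.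
From mathcomp Require Import all_classical all_reals topology.

Set Implicit Arguments.
Unset Strict Implicit.
Unset Printing Implicit Defensive.

Import Order.TTheory GRing.Theory Num.Theory.

Local Open Scope classical_set_scope.
Local Open Scope ring_scope.

Record language := Language {
  fsym : Type;
  farity : fsym -> nat;
  rsym : Type;
  rarity : rsym -> nat }.

Record structure (L : language) (M : Type) := Structure {
  finterp : forall f : fsym L, ('I_(farity f) -> M) -> M;
  rinterp : forall r : rsym L, ('I_(rarity r) -> M) -> Prop }.

(* Terms and formulas whose free variables are among n variables indexed by
   'I_n. A quantifier binds the variable ord0 of its body; the variable i of
   the context is lift ord0 i inside the body. *)
Inductive term (L : language) (n : nat) : Type :=
| TVar of 'I_n
| TApp (f : fsym L) of ('I_(farity f) -> term L n).

Inductive formula (L : language) : nat -> Type :=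
| FEq n of term L n & term L n : formula L n
| FRel n (r : rsym L) of ('I_(rarity r) -> term L n) : formula L n
| FNot n of formula L n : formula L n
| FAnd n of formula L n & formula L n : formula L n
| FOr n of formula L n & formula L n : formula L n
| FAll n of formula L n.+1 : formula L n
| FEx n of formula L n.+1 : formula L n.

Definition extend (M : Type) (n : nat) (a : M) (x : 'I_n -> M) : 'I_n.+1 -> M :=
  fun i => if unlift ord0 i is Some j then x j else a.

Fixpoint eval (L : language) (M : Type) (S : structure L M) (n : nat)
    (x : 'I_n -> M) (t : term L n) : M :=
  match t with
  | TVar i => x i
  | TApp f ts => finterp S (fun i => eval S x (ts i))
  end.

Fixpoint sat (L : language) (M : Type) (S : structure L M) (n : nat)
    (phi : formula L n) : ('I_n -> M) -> Prop :=
  match phi in formula _ n return ('I_n -> M) -> Prop with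
  | FEq _ s t => fun x => eval S x s = eval S x t
  | FRel _ r ts => fun x => rinterp S (fun i => eval S x (ts i))
  | FNot _ p => fun x => ~ sat S p x
  | FAnd _ p q => fun x => sat S p x /\ sat S q x
  | FOr _ p q => fun x => sat S p x \/ sat S q x
  | FAll _ p => fun x => forall a : M, sat S p (extend a x)
  | FEx _ p => fun x => exists a : M, sat S p (extend a x)
  end.

Definition lang_sum (L1 L2 : language) : language := {|
  fsym := fsym L1 + fsym L2;
  farity := fun f => match f with inl g => farity g | inr g => farity g end;
  rsym := rsym L1 + rsym L2;
  rarity := fun r => match r with inl s => rarity s | inr s => rarity s end |}.

(* The expansion of S by the interpretations T of the additional symbols L2. *)
Definition expansion (L1 L2 : language) (M : Type)
    (S : structure L1 M) (T : structure L2 M) : structure (lang_sum L1 L2) M :=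
  @Structure (lang_sum L1 L2) M
    (fun f => match f return ('I_(@farity (lang_sum L1 L2) f) -> M) -> M with
              | inl g => @finterp _ _ S g
              | inr g => @finterp _ _ T g
              end)
    (fun r => match r return ('I_(@rarity (lang_sum L1 L2) r) -> M) -> Prop with
              | inl s => @rinterp _ _ S s
              | inr s => @rinterp _ _ T s
              end).

Definition const_language (M : Type) : language := {|
  fsym := M; farity := fun=> 0%N;
  rsym := Empty_set; rarity := fun r => match r with end |}.

Definition const_structure (M : Type) : structure (const_language M) M :=
  @Structure (const_language M) M
    (fun (a : M) (_ : 'I_0 -> M) => a)
    (fun r : Empty_set => match r with end).

(* Definability with parameters: by a formula of the language enlarged by a
   constant symbol for each element of M. *)
Definition definable (L : language) (M : Type) (S : structure L M) (n : nat)
    (A : set ('I_n -> M)) : Prop :=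
  exists phi : formula (lang_sum L (const_language M)) n,
    A = [set x | sat (expansion S (const_structure M)) phi x].

Definition definable1 (L : language) (M : Type) (S : structure L M)
    (A : set M) : Prop :=
  definable S [set x : 'I_1 -> M | A (x ord0)].

Definition definable2 (L : language) (M : Type) (S : structure L M)
    (Y : set (M * M)) : Prop :=
  definable S [set x : 'I_2 -> M | Y (x ord0, x ord_max)].

Inductive ofield_fsym := OfZero | OfOne | OfAdd | OfOpp | OfMul.

Inductive ofield_rsym := OfLt.

Definition ofield_language : language := {|
  fsym := ofield_fsym;
  farity := fun f => match f with
                     | OfZero | OfOne => 0%N
                     | OfOpp => 1%N
                     | OfAdd | OfMul => 2%N
                     end;
  rsym := ofield_rsym;
  rarity := fun=> 2%N |}.

Definition ofield_structure (K : realFieldType) : structure ofield_language K :=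
  @Structure ofield_language K
    (fun f => match f return ('I_(@farity ofield_language f) -> K) -> K with
              | OfZero => fun=> 0
              | OfOne => fun=> 1
              | OfAdd => fun x => x ord0 + x ord_max
              | OfOpp => fun x => - x ord0
              | OfMul => fun x => x ord0 * x ord_max
              end)
    (fun r (x : 'I_2 -> K) => x ord0 < x ord_max).

(* The empty set, which has no supremum in K, is excluded. *)
Definition definably_complete (L : language) (K : realFieldType)
    (S : structure L K) : Prop :=
  forall A : set K, definable1 S A -> A !=set0 ->
    has_ubound A -> has_lbound A -> supremums A !=set0.

Definition nowhere_dense (T : topologicalType) (A : set T) : Prop :=
  (closure A)° = set0.

Definition definably_Baire (L : language) (K : realFieldType)
    (S : structure L K) : Prop :=
  ~ exists Y : set (K * K),
    [/\ definable2 S Y,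
        Y `<=` [set bt | 0 < bt.2],
        forall t : K, 0 < t ->
          nowhere_dense (ysection Y t : set (order_topology K)),
        forall s t : K, 0 < s -> 0 < t -> s < t ->
          ysection Y s `<=` ysection Y t
      & \bigcup_(t in [set t : K | 0 < t]) ysection Y t = [set: K]].

(* The type of elements of a subfield K of R, with the operations and the order
   of R restricted to K. *)
Record subfield_of (R : realType) (K : divringClosed R) := SubfieldOf {
  sfval :> R;
  sfvalP : sfval \in K }.

Section SubfieldTheory.

Variables (R : realType) (K : divringClosed R).
Local Notation F := (subfield_of K).

HB.instance Definition _ := [isSub for @sfval R K].
HB.instance Definition _ := [Choice of F by <:].
HB.instance Definition _ := [SubChoice_isSubIntegralDomain of F by <:].
HB.instance Definition _ := [SubIntegralDomain_isSubField of F by <:].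
HB.instance Definition _ := [SubChoice_isSubOrder of F by <: with ring_display].

Lemma sf_norm_subproof (x : F) : `|val x| \in K.
Proof. by case: (ger0P (val x)) => _; rewrite ?rpredN; apply: valP. Qed.

Definition sf_norm (x : F) : F := SubfieldOf (sf_norm_subproof x).

Lemma sf_leE (x y : F) : (x <= y) = (val x <= val y).
Proof. by []. Qed.

Lemma sf_ltE (x y : F) : (x < y) = (val x < val y).
Proof. by []. Qed.

Lemma sf_ler_normD (x y : F) : sf_norm (x + y) <= sf_norm x + sf_norm y.
Proof. exact: ler_normD. Qed.

Lemma sf_normr0_eq0 (x : F) : sf_norm x = 0 -> x = 0.
Proof. by move=> /(congr1 val) /= /normr0_eq0 x0; apply: val_inj. Qed.

Lemma sf_normrMn (x : F) n : sf_norm (x *+ n) = sf_norm x *+ n.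
Proof.
have valMn (y : F) m : sfval (y *+ m) = sfval y *+ m by exact: (raddfMn val).
by apply: val_inj; rewrite /= !valMn /= normrMn.
Qed.

Lemma sf_normrN (x : F) : sf_norm (- x) = sf_norm x.
Proof. by apply: val_inj; rewrite /= normrN. Qed.

HB.instance Definition _ := Num.Zmodule_isNormed.Build F F
  sf_ler_normD sf_normr0_eq0 sf_normrMn sf_normrN.

Lemma sf_addr_gt0 (x y : F) : 0 < x -> 0 < y -> 0 < x + y.
Proof. exact: addr_gt0. Qed.

Lemma sf_ger_leVge (x y : F) : 0 <= x -> 0 <= y -> (x <= y) || (y <= x).
Proof. by move=> _ _; apply: le_total. Qed.

Lemma sf_normrM : {morph (fun x : F => `|x|) : x y / x * y}.
Proof. by move=> x y; apply: val_inj; rewrite /= normrM. Qed.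

Lemma sf_ler_def (x y : F) : (x <= y) = (`|y - x| == y - x).
Proof. by rewrite -val_eqE /= sf_leE ler_def. Qed.

HB.instance Definition _ := Num.isNumRing.Build F
  sf_addr_gt0 sf_ger_leVge sf_normrM sf_ler_def.

End SubfieldTheory.

(* Main.v *)
(* For every t let X t be the closure of Y_t in [0, 1] with the endpoints 0 and
   1 added; a gap of X t is a component of [0, 1] \ X t.  In an archimedean
   field only finitely many gaps of X t exceed a given length.  This yields a
   definable cofinal set D of levels that is finite below each bound: if some
   X t is infinite, it has arbitrarily close points, and the inverses of its gap
   lengths will do; otherwise the times at which points enter the family do.

   Along D = {d_0 < d_1 < ...} follow a path of nested gaps, choosing at each
   level the longest (then leftmost) gap inside the current one among those that
   replace its older endpoint.  Since a point x determines all the gaps that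
   contain it, "x lies on the path up to level d" is first order: no recursion
   has to be coded.  So the left endpoints of the path form a definable set, and
   its supremum lies in every gap of the path, hence in no X t. *)
From HB Require Import structures.
From mathcomp Require Import all_boot all_order all_algebra.
From mathcomp Require Import all_classical all_reals topology.
From mathcomp Require Import lra.
Require Import Defs.

Set Implicit Arguments.
Unset Strict Implicit.
Unset Printing Implicit Defensive.

Import Order.TTheory GRing.Theory Num.Theory.

Local Open Scope classical_set_scope.
Local Open Scope ring_scope.

(** * Substitution and definability *)

Section Substitution.

Variables (L : language) (M : Type) (S : structure L M).

Lemma extend0 n (a : M) (x : 'I_n -> M) : extend a x ord0 = a.
Proof. by rewrite /extend unlift_none. Qed.

Lemma extend_lift n (a : M) (x : 'I_n -> M) i :
  extend a x (lift ord0 i) = x i.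
Proof. by rewrite /extend liftK. Qed.

Fixpoint term_subst n m (s : 'I_n -> term L m) (t : term L n) : term L m :=
  match t with
  | TVar i => s i
  | TApp f ts => TApp (fun i => term_subst s (ts i))
  end.

Lemma eval_term_subst n m (s : 'I_n -> term L m) (x : 'I_m -> M) t :
  eval S x (term_subst s t) = eval S (fun i => eval S x (s i)) t.
Proof.
by elim: t => //= f ts IH; congr finterp; apply/funext => i; exact: IH.
Qed.

Definition subst_lift n m (s : 'I_n -> term L m) : 'I_n.+1 -> term L m.+1 :=
  fun i => if unlift ord0 i is Some j
           then term_subst (fun k => TVar L (lift ord0 k)) (s j)
           else TVar L ord0.

Lemma eval_subst_lift n m (s : 'I_n -> term L m) (a : M) (x : 'I_m -> M) :
  (fun i => eval S (extend a x) (subst_lift s i)) =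
  extend a (fun i => eval S x (s i)).
Proof.
apply/funext => i; rewrite /subst_lift {2}/extend.
case: unlift => [j|/=]; last by rewrite extend0.
rewrite eval_term_subst; congr eval; apply/funext => k /=.
by rewrite extend_lift.
Qed.

Fixpoint formula_subst n (phi : formula L n) :
    forall m, ('I_n -> term L m) -> formula L m :=
  match phi in formula _ n
  return forall m, ('I_n -> term L m) -> formula L m with
  | FEq _ t u => fun m s => FEq (term_subst s t) (term_subst s u)
  | FRel _ r ts => fun m s => FRel (fun i => term_subst s (ts i))
  | FNot _ p => fun m s => FNot (formula_subst p s)
  | FAnd _ p q => fun m s => FAnd (formula_subst p s) (formula_subst q s)
  | FOr _ p q => fun m s => FOr (formula_subst p s) (formula_subst q s)
  | FAll _ p => fun m s => FAll (formula_subst p (subst_lift s))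
  | FEx _ p => fun m s => FEx (formula_subst p (subst_lift s))
  end.

Lemma sat_formula_subst n (phi : formula L n) m (s : 'I_n -> term L m) x :
  sat S (formula_subst phi s) x = sat S phi (fun i => eval S x (s i)).
Proof.
elim: phi m s x => {n} /=
  [n t u|n r ts|n p IH|n p IHp q IHq|n p IHp q IHq|n p IH|n p IH] m s x.
- by rewrite !eval_term_subst.
- by congr rinterp; apply/funext => i; rewrite eval_term_subst.
- by rewrite IH.
- by rewrite IHp IHq.
- by rewrite IHp IHq.
- by apply: eq_forall => a; rewrite IH eval_subst_lift.
- by apply: eq_exists => a; rewrite IH eval_subst_lift.
Qed.

End Substitution.

Section Definability.

Variables (L : language) (M : Type) (S : structure L M).

Definition binary_args (A : Type) (a b : A) (i : 'I_2) : A :=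
  if i == ord0 then a else b.

Definition definable_fun n (f : ('I_n -> M) -> M) : Prop :=
  exists t : term (lang_sum L (const_language M)) n,
    f = fun x => eval (expansion S (const_structure M)) x t.

Lemma definable_fun_var n (i : 'I_n) : definable_fun (fun x => x i).
Proof. by exists (TVar _ i). Qed.

Lemma definable_fun_cst n (c : M) : @definable_fun n (fun=> c).
Proof.
by exists (@TApp (lang_sum L (const_language M)) n (inr c)
  (fun i => TVar _ (widen_ord (leq0n n) i))).
Qed.

Lemma definable_preimage n m (A : set ('I_n -> M))
    (f : 'I_n -> ('I_m -> M) -> M) :
  definable S A -> (forall i, definable_fun (f i)) ->
  definable S [set x | A (fun i => f i x)].
Proof.
move=> [phi ->] /choice[s fs]; exists (formula_subst phi s).
apply/funext => x /=; rewrite sat_formula_subst; congr sat.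
by apply/funext => i; rewrite fs.
Qed.

Lemma definable1_preimage n (A : set M) (f : ('I_n -> M) -> M) :
  definable1 S A -> definable_fun f -> definable S [set x | A (f x)].
Proof. by move=> dA df; exact: (definable_preimage (f := fun=> f) dA). Qed.

Lemma definable2_preimage n (A : set (M * M)) (f g : ('I_n -> M) -> M) :
  definable2 S A -> definable_fun f -> definable_fun g ->
  definable S [set x | A (f x, g x)].
Proof.
move=> dA df dg; apply: (definable_preimage (f := binary_args f g) dA) => i.
by rewrite /binary_args; case: ifP.
Qed.

Lemma definable_eq n (f g : ('I_n -> M) -> M) :
  definable_fun f -> definable_fun g -> definable S [set x | f x = g x].
Proof. by move=> [t ->] [u ->]; exists (FEq t u). Qed.

Lemma definable_setC n (A : set ('I_n -> M)) :
  definable S A -> definable S (~` A).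
Proof. by move=> [p ->]; exists (FNot p). Qed.

Lemma definable_setI n (A B : set ('I_n -> M)) :
  definable S A -> definable S B -> definable S (A `&` B).
Proof. by move=> [p ->] [q ->]; exists (FAnd p q). Qed.

Lemma definable_setU n (A B : set ('I_n -> M)) :
  definable S A -> definable S B -> definable S (A `|` B).
Proof. by move=> [p ->] [q ->]; exists (FOr p q). Qed.

Lemma definable_imply n (A B : set ('I_n -> M)) :
  definable S A -> definable S B -> definable S [set x | A x -> B x].
Proof.
move=> dA dB; rewrite (_ : mkset _ = ~` A `|` B); last first.
  by apply/funext => x; apply/propext; rewrite /= implyE.
by apply: definable_setU => //; exact: definable_setC.
Qed.

Lemma definable_and3 n (A B C : set ('I_n -> M)) :
  definable S A -> definable S B -> definable S C ->
  definable S [set x | [/\ A x, B x & C x]].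
Proof.
move=> dA dB dC; rewrite (_ : mkset _ = A `&` (B `&` C)); last first.
  by apply/seteqP; split=> x [] // ? [].
by do 2![apply: definable_setI => //].
Qed.

Lemma definable_and4 n (A B C D : set ('I_n -> M)) :
  definable S A -> definable S B -> definable S C -> definable S D ->
  definable S [set x | [/\ A x, B x, C x & D x]].
Proof.
move=> dA dB dC dD; rewrite (_ : mkset _ = A `&` (B `&` (C `&` D))); last first.
  by apply/seteqP; split=> x [] // ? [? []].
by do 3![apply: definable_setI => //].
Qed.

Lemma definable_andb n (a b : ('I_n -> M) -> bool) :
  definable S [set x | a x] -> definable S [set x | b x] ->
  definable S [set x | a x && b x].
Proof.
move=> da db; rewrite (_ : mkset _ = [set x | a x] `&` [set x | b x]).
  exact: definable_setI.
by apply/seteqP; split=> x /andP.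
Qed.

Lemma definable_forall n (P : ('I_n -> M) -> M -> Prop) :
  definable S [set y : 'I_n.+1 -> M | P (fun i => y (lift ord0 i)) (y ord0)] ->
  definable S [set x | forall a, P x a].
Proof.
move=> [p Pp]; exists (FAll p); apply/funext => x /=; apply: eq_forall => a.
move/(congr1 (@^~ (extend a x))): Pp => /= <-; rewrite extend0.
by congr P; apply/funext => i; rewrite extend_lift.
Qed.

Lemma definable_exists n (P : ('I_n -> M) -> M -> Prop) :
  definable S [set y : 'I_n.+1 -> M | P (fun i => y (lift ord0 i)) (y ord0)] ->
  definable S [set x | exists a, P x a].
Proof.
move=> dP; rewrite (_ : mkset _ = ~` [set x | forall a, ~ P x a]).
  by apply/definable_setC/definable_forall; exact: definable_setC.
by apply/funext => x; rewrite /setC /= forallNE notK.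
Qed.

Lemma definable_forall_pair n (P : ('I_n -> M) -> M * M -> Prop) :
  definable S [set y : 'I_n.+2 -> M |
    P (fun i => y (lift ord0 (lift ord0 i))) (y (lift ord0 ord0), y ord0)] ->
  definable S [set x | forall a, P x a].
Proof.
move=> dP; rewrite (_ : mkset _ = [set x | forall a b, P x (a, b)]).
  by do 2!apply: definable_forall.
by apply/seteqP; split=> x Px // [a b]; exact: Px.
Qed.

Lemma definable_exists_pair n (P : ('I_n -> M) -> M * M -> Prop) :
  definable S [set y : 'I_n.+2 -> M |
    P (fun i => y (lift ord0 (lift ord0 i))) (y (lift ord0 ord0), y ord0)] ->
  definable S [set x | exists a, P x a].
Proof.
move=> dP; rewrite (_ : mkset _ = [set x | exists a b, P x (a, b)]).
  by do 2!apply: definable_exists.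
apply/seteqP; split=> x; first by move=> [[a b] Px]; exists a, b.
by move=> [a [b Px]]; exists (a, b).
Qed.

Definition definable_family (X : M -> set M) : Prop :=
  definable2 S [set tx | X tx.1 tx.2].

Lemma definable_family_preimage n (X : M -> set M) (f g : ('I_n -> M) -> M) :
  definable_family X -> definable_fun f -> definable_fun g ->
  definable S [set x | X (f x) (g x)].
Proof. exact: definable2_preimage. Qed.

Lemma definable_family_section (X : M -> set M) t :
  definable_family X -> definable1 S (X t).
Proof.
move=> dX; apply: (definable_family_preimage dX).
- exact: definable_fun_cst.
- exact: definable_fun_var.
Qed.

End Definability.

Section OrderedFieldDefinability.

Variables (F : realFieldType) (L : language) (T : structure L F).
Local Notation S := (expansion (ofield_structure F) T).
Local Notation LF := (lang_sum (lang_sum ofield_language L) (const_language F)).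

Lemma definable_fun_opp n (f : ('I_n -> F) -> F) :
  definable_fun S f -> definable_fun S (fun x => - f x).
Proof. by move=> [t ->]; exists (@TApp LF n (inl (inl OfOpp)) (fun=> t)). Qed.

Lemma definable_fun_add n (f g : ('I_n -> F) -> F) :
  definable_fun S f -> definable_fun S g ->
  definable_fun S (fun x => f x + g x).
Proof.
move=> [t ->] [u ->].
by exists (@TApp LF n (inl (inl OfAdd)) (binary_args t u)).
Qed.

Lemma definable_fun_mul n (f g : ('I_n -> F) -> F) :
  definable_fun S f -> definable_fun S g ->
  definable_fun S (fun x => f x * g x).
Proof.
move=> [t ->] [u ->].
by exists (@TApp LF n (inl (inl OfMul)) (binary_args t u)).
Qed.

Lemma definable_lt n (f g : ('I_n -> F) -> F) :
  definable_fun S f -> definable_fun S g -> definable S [set x | f x < g x].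
Proof.
move=> [t ->] [u ->].
by exists (@FRel LF n (inl (inl OfLt)) (binary_args t u)).
Qed.

Lemma definable_le n (f g : ('I_n -> F) -> F) :
  definable_fun S f -> definable_fun S g -> definable S [set x | f x <= g x].
Proof.
move=> df dg; rewrite (_ : mkset _ = ~` [set x | g x < f x]).
  by apply: definable_setC; exact: definable_lt.
by apply/funext => x; rewrite /setC /= leNgt; apply/propext; split=> /negP.
Qed.

End OrderedFieldDefinability.

Ltac definability_step :=
  lazymatch goal with
  | |- definable _ (fun x => _ /\ _) => apply: definable_setI
  | |- definable _ (fun x => [/\ _, _ & _]) => apply: definable_and3
  | |- definable _ (fun x => [/\ _, _, _ & _]) => apply: definable_and4
  | |- definable _ (fun x => _ \/ _) => apply: definable_setU
  | |- definable _ (fun x => ~ _) => apply: definable_setC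
  | |- definable _ (fun x => forall a : _ * _, _) =>
      apply: definable_forall_pair
  | |- definable _ (fun x => exists a : _ * _, _) =>
      apply: definable_exists_pair
  | |- definable _ (fun x => forall a, _) =>
      first [apply: definable_imply | apply: definable_forall]
  | |- definable _ (fun x => exists a, _) => apply: definable_exists
  | |- definable _ (fun x => is_true (_ && _)) => apply: definable_andb
  | |- definable _ (fun x => is_true (_ < _)) => apply: definable_lt
  | |- definable _ (fun x => is_true (_ <= _)) => apply: definable_le
  | |- definable _ (fun x => _ = _) => apply: definable_eq
  | |- definable_fun _ (fun x => _ + _) => apply: definable_fun_add
  | |- definable_fun _ (fun x => _ * _) => apply: definable_fun_mul
  | |- definable_fun _ (fun x => - _) => apply: definable_fun_opp
  | |- definable_fun _ (fun x => x _) => exact: definable_fun_var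
  | |- definable_fun _ (fun=> _) => exact: definable_fun_cst
  | H : definable1 _ ?A |- definable _ (fun x => ?A _) =>
      apply: (definable1_preimage H)
  | H : definable2 _ ?A |- definable _ (fun x => ?A (_, _)) =>
      apply: (definable2_preimage H)
  | H : definable_family _ ?X |- definable _ (fun x => ?X _ _) =>
      apply: (definable_family_preimage H)
  end.

Ltac definability :=
  rewrite ?/definable1 ?/definable_family ?/definable2;
  repeat (rewrite /=; cbv beta delta [mkset]; definability_step).

(** * Order topology and locally finite sets *)

Lemma nowhere_denseS (T : topologicalType) (A B : set T) :
  A `<=` B -> nowhere_dense B -> nowhere_dense A.
Proof.
by move=> /closureS/interiorS AB B0; rewrite /nowhere_dense -subset0 -B0.
Qed.

Lemma nowhere_denseU (T : topologicalType) (A B : set T) :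
  nowhere_dense A -> nowhere_dense B -> nowhere_dense (A `|` B).
Proof.
rewrite /nowhere_dense closureU => A0 B0; rewrite -subset0.
set U := _°; have openU : open U by exact: open_interior.
have UB : U `\` closure B `<=` (closure A)°.
  rewrite -open_subsetE; last first.
    by rewrite setDE; apply: openI => //; rewrite openC; exact: closed_closure.
  by move=> x [/interior_subset[]].
rewrite -B0 -open_subsetE // => x Ux; apply: contrapT => nBx.
by have := UB x (conj Ux nBx); rewrite A0.
Qed.

Lemma closure_orderP (F : realDomainType) (A : set (order_topology F)) x :
  closure A x <-> forall u v : F, u < x < v -> exists2 y : F, A y & u < y < v.
Proof.
split=> [clAx u v uxv|AP U].
  have [|y [Ay yuv]] := clAx `]u, v[%classic.
    by apply: open_nbhs_nbhs; split; [exact: itv_open | rewrite /= in_itv].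
  by exists y => //; rewrite /= in_itv in yuv.
rewrite itv_nbhsE => -[i [iopen xi] iU].
suff [u [v [uxv uvi]]] : exists u v : F,
    u < x < v /\ `]u, v[%classic `<=` [set` i].
  have [y Ay yuv] := AP u v uxv; exists y; split=> //.
  by apply/iU/uvi; rewrite /= in_itv.
have [x_lt lt_x] : x < x + 1 /\ x - 1 < x by rewrite ltrDl gtrBl ltr01.
case: i {iU} iopen xi => -[[]l|[]] [[]r|[]] //= _; rewrite in_itv /= ?andbT.
- by move=> lxr; exists l, r; split.
- move=> lx; exists l, (x + 1); rewrite lx x_lt; split=> // y /=.
  by rewrite !in_itv /= andbT => /andP[].
- move=> xr; exists (x - 1), r; rewrite xr lt_x; split=> // y /=.
  by rewrite !in_itv /= => /andP[].
- by move=> _; exists (x - 1), (x + 1); rewrite lt_x x_lt; split.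
Qed.

Lemma closed_order_set1 (F : realFieldType) (a : order_topology F) :
  closed [set a].
Proof. exact/accessible_closed_set1/hausdorff_accessible/order_hausdorff. Qed.

Lemma nowhere_dense_set1 (F : realFieldType) (a : order_topology F) :
  nowhere_dense [set a].
Proof.
rewrite /nowhere_dense -(closure_id _).1; last exact: closed_order_set1.
rewrite -subset0 -[X in X°]setCK interiorC => z; apply.
have [->|/eqP zNa] := eqVneq z a; last exact: subset_closure.
apply/closure_orderP => u v /andP[ua av].
by exists ((u + a) / 2); [apply/eqP; rewrite lt_eqF // | ]; lra.
Qed.

Lemma nowhere_dense_itv (F : realFieldType) (A : set (order_topology F))
    (a b : F) :
  nowhere_dense A -> a < b -> exists2 x : F, a < x < b & ~ closure A x.
Proof.
move=> A0 ab; apply: contrapT => AP.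
suff : (closure A)° ((a + b) / 2) by rewrite A0.
have abA : (`]a, b[%classic : set (order_topology F)) `<=` closure A.
  move=> x; rewrite /= in_itv => xab.
  by apply: contrapT => nAx; apply: AP; exists x.
rewrite (open_subsetE _ (@itv_open _ (order_topology F) a b)) in abA.
by apply: abA; rewrite /= in_itv /=; lra.
Qed.

Lemma finite_set_min d (T : orderType d) (A : set T) :
  finite_set A -> A !=set0 -> exists2 m, A m & lbound A m.
Proof.
move=> /finite_seqP[s ->] [x xs].
have := sort_sorted (@le_total _ T) s; have := mem_sort <=%O s.
case: (sort _ s) => [|m t] mem_t sorted_t; first by rewrite /= -mem_t in xs.
exists m => [|y] /=; rewrite -mem_t ?mem_head // inE => /predU1P[->//|].
exact: (allP (order_path_min le_trans sorted_t)).
Qed.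

Lemma finite_set_argmin d (T : orderType d) (I : Type) (A : set I)
    (f : I -> T) :
  finite_set A -> A !=set0 -> exists2 a, A a & forall b, A b -> (f a <= f b)%O.
Proof.
move=> finA A0; have [||_ [a Aa <-] amin] := @finite_set_min _ _ (f @` A).
- exact: finite_image.
- by case: A0 => a Aa; exists (f a); exists a.
- by exists a => // b Ab; apply: amin; exists b.
Qed.

Section CofinalSequences.

Variables (d : Order.disp_t) (T : orderType d).
Implicit Types (D : set T) (lev : nat -> T).
Local Open Scope order_scope.

Definition locally_finite_below D :=
  forall s, finite_set (D `&` [set x | x <= s]).

Definition cofinal D := forall s, exists2 x, D x & s < x.

Definition successor_in D x y :=
  [/\ D x, D y, x < y & forall z, D z -> x < z -> y <= z].

Lemma locally_finite_below_min D A : locally_finite_below D -> A `<=` D ->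
  A !=set0 -> exists2 m, A m & lbound A m.
Proof.
move=> finD AD [a Aa].
have [||m [Am ma] mmin] := @finite_set_min _ _ (A `&` [set x | x <= a]).
- by apply: sub_finite_set (finD a) => x [/AD].
- by exists a; split=> /=.
exists m => // x Ax; have [xa|/ltW ax] := leP x a; first exact: mmin.
exact: le_trans ma ax.
Qed.

Lemma cofinal_enum D (x0 : T) : locally_finite_below D -> cofinal D ->
  exists2 lev, range lev = D & {mono lev : m n / (m <= n)%N >-> m <= n}.
Proof.
move=> finD cofD.
have [//||first Dfirst first_min] := locally_finite_below_min finD (A := D).
  by have [x Dx _] := cofD x0; exists x.
pose above x := D `&` [set z | x < z].
have /choice[next next_succ] x : exists y, lbound (above x) y /\ D y /\ x < y.
  have [||y [Dy xy] ymin] := locally_finite_below_min finD (A := above x).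
  - by move=> z [].
  - by have [y Dy xy] := cofD x; exists y.
  - by exists y.
pose lev n := iter n next first.
have levD n : D (lev n) by case: n => [//|n]; case: (next_succ (lev n)) => _ [].
have lev_lt : {homo lev : m n / (m < n)%N >-> m < n}.
  by apply: homo_ltn lt_trans _ => n; case: (next_succ (lev n)) => _ [].
have lev_mono : {mono lev : m n / (m <= n)%N >-> m <= n} by exact: le_mono.
exists lev => //; apply/seteqP; split=> [_ [n _ <-] //|x Dx].
apply: contrapT => nlev.
have levNx n : lev n != x by apply: contra_notN nlev => /eqP <-; exists n.
have lev_x n : lev n < x.
  rewrite lt_neqAle levNx /=; elim: n => [|n IHn]; first exact: first_min.
  have [+ _] := next_succ (lev n); apply; split=> //=.
  by rewrite lt_neqAle levNx.
apply: infinite_nat; rewrite (_ : setT = lev @^-1` (D `&` [set y | y <= x])).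
  by apply: finite_preimage (finD x) => m n _ _; exact: (inc_inj lev_mono).
by apply/seteqP; split=> // n _; split; [|exact: ltW].
Qed.

Lemma successor_in_range lev : {mono lev : m n / (m <= n)%N >-> m <= n} ->
  forall x y, successor_in (range lev) x y <->
    exists2 n, x = lev n & y = lev n.+1.
Proof.
move=> lev_mono x y.
have lev_lt m n : (lev m < lev n) = (m < n)%N by exact: (leW_mono lev_mono).
split.
  move=> [[m _ <-] [n _ <-] mn nmin]; exists m => //; congr lev; apply/anti_leq.
  by rewrite -lev_lt mn andbT -lev_mono nmin ?lev_lt //; exists m.+1.
move=> [n -> ->]; split; rewrite ?lev_lt // => _ [m _ <-].
by rewrite lev_lt lev_mono.
Qed.

End CofinalSequences.

Lemma separated_finite_set (F : archiRealFieldType) (I : Type) (A : set I)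
    (f : I -> F) (lo hi e : F) : 0 < e ->
    (forall a, A a -> lo <= f a <= hi) ->
    (forall a b, A a -> A b -> f a <= f b < f a + e -> a = b) ->
  finite_set A.
Proof.
move=> e0 f_itv sep; pose cell a := Num.truncn ((f a - lo) / e).
have cell_itv a : A a -> (cell a)%:R * e <= f a - lo < (cell a).+1%:R * e.
  move=> /f_itv/andP[loa _]; rewrite -ler_pdivlMr // -ltr_pdivrMr //.
  by apply: truncn_itv; rewrite divr_ge0 ?subr_ge0 // ltW.
have cell_inj : {in A &, injective cell}.
  move=> a b; rewrite !inE => Aa Ab ab.
  wlog fab : a b Aa Ab ab / f a <= f b.
    by move=> wlog_le; case: (leP (f a) (f b)) => [|/ltW] /wlog_le->.
  apply: sep => //; rewrite fab /=.
  have := cell_itv a Aa; have := cell_itv b Ab; rewrite ab -natr1; lra.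
rewrite -(eq_finite_set (inj_card_eq cell_inj)).
apply: sub_finite_set (finite_II (Num.truncn ((hi - lo) / e)).+1).
move=> _ [a Aa <-] /=.
rewrite ltnS; apply: le_truncn; rewrite ler_pM2r ?invr_gt0 // lerD2r.
by case/andP: (f_itv a Aa).
Qed.

(** * Gaps *)

Section Gaps.

Variables (d : Order.disp_t) (T : orderType d).
Local Open Scope order_scope.

Definition gap (C : set T) : set (T * T) := [set g |
  [/\ C g.1, C g.2, g.1 < g.2 & forall z, g.1 < z < g.2 -> ~ C z]].

Lemma gap_inj (C : set T) (g h : T * T) x : gap C g -> gap C h ->
  g.1 < x < g.2 -> h.1 < x < h.2 -> g = h.
Proof.
move=> Cg Ch gx hx.
suff le_gap (g' h' : T * T) : gap C g' -> gap C h' -> g'.1 < x < g'.2 ->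
    h'.1 < x < h'.2 -> h'.1 <= g'.1 /\ g'.2 <= h'.2.
  have [hg1 gh2] := le_gap _ _ Cg Ch gx hx.
  have [gh1 hg2] := le_gap _ _ Ch Cg hx gx.
  rewrite [g]surjective_pairing [h]surjective_pairing.
  by congr pair; exact/le_anti/andP.
move=> [_ _ _ g'P] [C1 C2 _ _] /andP[g1x xg2] /andP[h1x xh2].
split; rewrite leNgt; apply/negP => lt.
- by apply: (g'P h'.1) => //; rewrite lt (lt_trans h1x).
- by apply: (g'P h'.2) => //; rewrite lt (lt_trans g1x).
Qed.

End Gaps.

Definition midpoint (F : realFieldType) (g : F * F) : F := (g.1 + g.2) / 2.

Lemma gap_midpoint (F : realFieldType) (C : set F) g :
  gap C g -> g.1 < midpoint g < g.2.
Proof. by rewrite /midpoint => -[_ _]; lra. Qed.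

Section DefinableCompleteness.

Variables (F : realFieldType) (L : language) (T : structure L F).
Local Notation S := (expansion (ofield_structure F) T).
Hypothesis S_complete : definably_complete S.

Lemma definable1_supremums (A : set F) :
  definable1 S A -> A !=set0 -> has_ubound A -> supremums A !=set0.
Proof.
move=> dA [a Aa] [u Au].
have [||||c [cub clb]] := S_complete (A := A `&` [set x | a <= x]).
- by definability.
- by exists a; split=> /=.
- by exists u => x [/Au].
- by exists a => x [].
exists c; split=> [x Ax|v Av]; last by apply: clb => x [/Av].
have [ax|/ltW xa] := leP a x; first by apply: cub; split.
by apply: le_trans xa _; apply: cub; split=> /=.
Qed.

Lemma definable1_infimums (A : set F) :
  definable1 S A -> A !=set0 -> has_lbound A -> infimums A !=set0.
Proof.
move=> dA [a Aa] A_lb.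
have [|//||c [cub clb]] := definable1_supremums (A := lbound A).
- by rewrite /lbound; definability.
- by exists a => v; exact.
by exists c; split=> // x Ax; apply: clb => v; exact.
Qed.

Lemma gap_around (C : set F) x :
    definable1 S C -> closed (C : set (order_topology F)) ->
    (exists2 a, C a & a <= x) -> (exists2 b, C b & x <= b) -> ~ C x ->
  exists2 g, gap C g & g.1 < x < g.2.
Proof.
move=> dC closedC [a Ca ax] [b Cb xb] nCx.
have neq_x z : C z -> z != x by move=> Cz; apply: contra_notN nCx => /eqP <-.
pose below : set (order_topology F) := C `&` `]-oo, x].
pose above : set (order_topology F) := C `&` `[x, +oo[.
have belowE : below = C `&` [set z | z <= x] by rewrite /below set_itvE.
have aboveE : above = C `&` [set z | x <= z] by rewrite /above set_itvE.
have closed_below : closed below.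
  exact: closedI closedC (@lray_closed _ (order_topology F) x).
have closed_above : closed above.
  exact: closedI closedC (@rray_closed _ (order_topology F) x).
have below0 : below !=set0 by rewrite belowE; exists a.
have above0 : above !=set0 by rewrite aboveE; exists b.
have [|//||l supl] := definable1_supremums (A := below).
- by rewrite belowE; definability.
- by rewrite belowE; exists x => z [].
have [|//||r infr] := definable1_infimums (A := above).
- by rewrite aboveE; definability.
- by rewrite aboveE; exists x => z [].
have := itv_closed_supremums below0 closed_below supl.
have := itv_closed_infimums above0 closed_above infr.
rewrite -/above -/below aboveE belowE => -[Cr /= xr] [Cl /= lx].
have {}lx : l < x by rewrite lt_neqAle neq_x.
have {}xr : x < r by rewrite lt_neqAle eq_sym neq_x.
exists (l, r); rewrite /= ?lx //; split=> //=; first exact: lt_trans xr.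
move=> z /andP[lz zr] Cz; have [zx|/ltW xz] := leP z x.
- by case: supl => /(_ z); rewrite leNgt lz belowE => /(_ (conj Cz zx)).
- by case: infr => /(_ z); rewrite leNgt zr aboveE => /(_ (conj Cz xz)).
Qed.

Lemma gap_between (C : set F) y z :
    definable1 S C -> closed (C : set (order_topology F)) ->
    nowhere_dense (C : set (order_topology F)) -> C y -> C z -> y < z ->
  exists2 g, gap C g & y <= g.1 /\ g.2 <= z.
Proof.
move=> dC closedC ndC Cy Cz yz.
have [x /andP[yx xz]] := nowhere_dense_itv ndC yz.
rewrite -(closure_id _).1 // => nCx.
have [||g Cg /andP[g1x xg2]] := gap_around dC closedC _ _ nCx.
- by exists y => //; exact: ltW.
- by exists z => //; exact: ltW.
exists g => //; case: Cg => _ _ _ gP; split; rewrite leNgt; apply/negP => lt.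
- by apply: (gP y) => //; rewrite lt (lt_trans yx).
- by apply: (gP z) => //; rewrite lt (lt_trans g1x).
Qed.

End DefinableCompleteness.

Section BoundedSets.

Variables (F : archiRealFieldType) (C : set F) (lo hi : F).
Hypothesis C_itv : forall x, C x -> lo <= x <= hi.

Lemma gap_sub_itv g x : gap C g -> g.1 < x < g.2 -> lo <= x <= hi.
Proof. by move=> [/C_itv + /C_itv]; lra. Qed.

Lemma long_gaps_finite (e : F) : 0 < e ->
  finite_set (gap C `&` [set g | e <= g.2 - g.1]).
Proof.
move=> e0; apply: (@separated_finite_set F _ _ fst lo hi e) => //.
  by move=> g [[Cg _ _ _] _]; exact: C_itv.
move=> g h [Cg /= eg] [Ch /= eh] gh.
by apply: (@gap_inj _ _ C _ _ ((h.1 + g.1 + e) / 2)) => //; lra.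
Qed.

Lemma infinite_set_close_points (e : F) : infinite_set C -> 0 < e ->
  exists y z, [/\ C y, C z & y < z < y + e].
Proof.
move=> infC e0; apply: contrapT => far; apply: infC.
apply: (@separated_finite_set F _ _ id lo hi e) => // y z Cy Cz /=.
move=> /andP[+ zy]; rewrite le_eqVlt => /predU1P[//|yz]; case: far.
by exists y, z; split=> //; rewrite yz.
Qed.

Definition inverse_gap_lengths : set F :=
  [set x | exists g, gap C g /\ x * (g.2 - g.1) = 1].

Lemma inverse_gap_lengths_locally_finite :
  locally_finite_below inverse_gap_lengths.
Proof.
move=> s; pose u := Num.max s 1; have u0 : 0 < u by rewrite lt_max ltr01 orbT.
have finG : finite_set (gap C `&` [set g | u^-1 <= g.2 - g.1]).
  by apply: long_gaps_finite; rewrite invr_gt0.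
apply: sub_finite_set (finite_image (fun g => (g.2 - g.1)^-1) finG).
move=> x [[g [Cg xg]] /= xs]; have g0 : 0 < g.2 - g.1 by case: Cg; lra.
have xE : x = (g.2 - g.1)^-1.
  by apply: (mulIf (lt0r_neq0 g0)); rewrite xg mulVf // lt0r_neq0.
exists g => //; split=> //=; rewrite -[leRHS]invrK lef_pV2 ?posrE ?invr_gt0 //.
by rewrite -xE le_max xs.
Qed.

Lemma inverse_gap_lengths_cofinal (L : language) (T : structure L F) :
    definably_complete (expansion (ofield_structure F) T) ->
    definable1 (expansion (ofield_structure F) T) C ->
    closed (C : set (order_topology F)) ->
    nowhere_dense (C : set (order_topology F)) -> infinite_set C ->
  cofinal inverse_gap_lengths.
Proof.
move=> S_complete dC closedC ndC infC s; pose u := Num.max s 0 + 1.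
have [su u0] : s < u /\ 0 < u.
  have [? ?] : s <= Num.max s 0 /\ 0 <= Num.max s 0.
    by rewrite !le_max !lexx orbT.
  by rewrite /u; split; lra.
have [|y [z [Cy Cz /andP[yz zy]]]] :=
    @infinite_set_close_points u^-1 infC; first by rewrite invr_gt0.
have [g Cg [yg gz]] := gap_between S_complete dC closedC ndC Cy Cz yz.
have g0 : 0 < g.2 - g.1 by case: Cg; lra.
exists (g.2 - g.1)^-1; first by exists g; rewrite mulVf // lt0r_neq0.
by apply: (lt_trans su); rewrite -[u]invrK ltf_pV2 ?posrE ?invr_gt0 //; lra.
Qed.

End BoundedSets.

(** * Filtrations of the unit interval by nowhere dense sets *)

Section Filtrations.

Variables (F : archiRealFieldType) (L : language) (T : structure L F).
Local Notation S := (expansion (ofield_structure F) T).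
Hypothesis S_complete : definably_complete S.

Variable X : F -> set F.
Hypothesis X_definable : definable_family S X.
Hypothesis X_closed : forall t, closed (X t : set (order_topology F)).
Hypothesis X_nowhere_dense :
  forall t, nowhere_dense (X t : set (order_topology F)).
Hypothesis X_itv : forall t x, X t x -> 0 <= x <= 1.
Hypothesis X_0 : forall t, X t 0.
Hypothesis X_1 : forall t, X t 1.
Hypothesis X_incr : forall s t, s <= t -> X s `<=` X t.

Lemma level_gap_between t y z : X t y -> X t z -> y < z ->
  exists2 g, gap (X t) g & y <= g.1 /\ g.2 <= z.
Proof.
by apply: (gap_between S_complete) => //; exact: definable_family_section.
Qed.

Section Levels.

Hypothesis X_cover : forall x : F, 0 <= x <= 1 -> exists t, X t x.

Definition entry_time x s :=
  (forall r, r < s -> ~ X r x) /\ (forall t, s < t -> X t x).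

Definition entry_times : set F := [set s | exists x, entry_time x s].

Lemma entry_time_le x s s' : entry_time x s -> entry_time x s' -> s <= s'.
Proof.
move=> [s_out _] [_ s'_in]; rewrite leNgt; apply/negP => s's.
by apply: (s_out ((s' + s) / 2)); [|apply: s'_in]; lra.
Qed.

Lemma entry_times_cofinal : cofinal entry_times.
Proof.
move=> s; have [x x01] := nowhere_dense_itv (X_nowhere_dense (s + 1)) ltr01.
rewrite -(closure_id _).1 // => nXx.
have [|t Xtx] := @X_cover x; first by lra.
have out_lt r : ~ X r x -> r < t.
  by move=> nXr; rewrite ltNge; apply/negP => /X_incr /(_ _ Xtx).
have [|||e [e_ub e_lub]] :=
    definable1_supremums S_complete (A := [set r | ~ X r x]).
- by definability.
- by exists (s + 1).
- by exists t => r /out_lt/ltW.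
exists e; last by have := e_ub _ nXx; lra.
exists x; split=> r.
- move=> re Xr; have : e <= r; last by rewrite leNgt re.
  by apply: e_lub => v nXv; rewrite leNgt; apply/negP => /ltW/X_incr /(_ _ Xr).
- by move=> er; apply: contrapT => /e_ub; rewrite leNgt er.
Qed.

Lemma entry_times_locally_finite :
  (forall t, finite_set (X t)) -> locally_finite_below entry_times.
Proof.
move=> finX s; pose time_of x := xget 0 [set e | entry_time x e].
apply: sub_finite_set (finite_image time_of (finX (s + 1))) => e [[x xe] /= es].
exists x; first by apply: xe.2; lra.
apply: xget_unique => // e' xe'; apply/le_anti.
by rewrite !(@entry_time_le x).
Qed.

Lemma exists_definable_levels : exists D : set F,
  [/\ definable1 S D, locally_finite_below D & cofinal D].
Proof.
have [[t infX]|finX] := pselect (exists t, infinite_set (X t)).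
  exists (inverse_gap_lengths (X t)); split.
  - by rewrite /inverse_gap_lengths /gap; definability.
  - exact: inverse_gap_lengths_locally_finite (X_itv (t := t)).
  - apply: (inverse_gap_lengths_cofinal (X_itv (t := t)) S_complete) => //.
    exact: definable_family_section.
exists entry_times; split.
- by rewrite /entry_times /entry_time; definability.
- apply: entry_times_locally_finite => t.
  by apply: contrapT => ?; apply: finX; exists t.
- exact: entry_times_cofinal.
Qed.

End Levels.

Definition older a b := exists t, X t a /\ ~ X t b.

Lemma older_asym a b : older a b -> ~ older b a.
Proof.
move=> [s [Xa nXb]] [t [Xb nXa]].
by case: (leP s t) => [/X_incr/(_ _ Xa)|/ltW/X_incr/(_ _ Xb)].
Qed.

Definition hits t (g : F * F) := exists z, X t z /\ g.1 < z < g.2.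

(* Moving the older endpoint whenever an endpoint has to move makes both
   endpoints of a path of gaps move; a rule without such memory could keep one
   of them fixed for ever. *)
Definition refinement t (g h : F * F) :=
  [/\ gap (X t) h, g.1 <= h.1, h.2 <= g.2 & hits t g ->
      (older g.1 g.2 -> g.1 < h.1) /\ (~ older g.1 g.2 -> h.2 < g.2)].

Lemma refinement_unhit t g h : ~ hits t g -> refinement t g h -> h = g.
Proof.
move=> nhit [[X1 X2 lt_h _] gh1 hg2 _].
have h1 : h.1 <= g.1.
  by rewrite leNgt; apply/negP => lt; apply: nhit; exists h.1; split=> //; lra.
have h2 : g.2 <= h.2.
  by rewrite leNgt; apply/negP => lt; apply: nhit; exists h.2; split=> //; lra.
rewrite [h]surjective_pairing [g]surjective_pairing.
by congr pair; exact/le_anti/andP.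
Qed.

Lemma refinement_twice s t u g h k : gap (X s) g ->
  hits t g -> refinement t g h -> hits u h -> refinement u h k ->
  g.1 < k.1 /\ k.2 < g.2.
Proof.
move=> [X1 X2 _ gP] hit_g [[_ _ lt_h _] gh1 hg2 /(_ hit_g)[g_old g_young]].
move=> hit_h [_ hk1 kh2 /(_ hit_h)[h_old h_young]].
have [g12|/g_young h2] := pselect (older g.1 g.2).
- have h1 := g_old g12; split; first exact: lt_le_trans hk1.
  have [h2|h2] := ltP h.2 g.2; first exact: le_lt_trans h2.
  have h2E : h.2 = g.2 by apply/le_anti; rewrite hg2.
  rewrite -h2E; apply/h_young/older_asym; rewrite h2E; exists s; split=> //.
  by apply: gP; rewrite h1 -h2E.
- split; last exact: le_lt_trans h2.
  have [h1|h1] := ltP g.1 h.1; first exact: lt_le_trans hk1.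
  have h1E : h.1 = g.1 by apply/le_anti; rewrite h1.
  rewrite -h1E; apply: h_old; rewrite h1E; exists s; split=> //.
  by apply: gP; rewrite h2 -h1E lt_h.
Qed.

Lemma refinement_exists s t g :
  s <= t -> gap (X s) g -> exists h, refinement t g h.
Proof.
move=> /X_incr Xst [/Xst X1 /Xst X2 lt_g _].
have [[z [Xz /andP[g1z zg2]]]|nhit] := pselect (hits t g); last first.
  exists g; split=> //; split=> // z gz Xz; by apply: nhit; exists z.
have [old|young] := pselect (older g.1 g.2).
- have [h Xh [zh hg]] := level_gap_between Xz X2 zg2.
  by exists h; split=> // [|_]; [lra | split=> // _; lra].
- have [h Xh [gh hz]] := level_gap_between X1 Xz g1z.
  by exists h; split=> // [|_]; [lra | split=> // _; lra].
Qed.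

Definition precedes (g h : F * F) :=
  h.2 - h.1 < g.2 - g.1 \/ h.2 - h.1 = g.2 - g.1 /\ g.1 <= h.1.

Definition next_gap t g h :=
  refinement t g h /\ forall k, refinement t g k -> precedes h k.

Lemma next_gap_exists s t g : s <= t -> gap (X s) g -> exists h, next_gap t g h.
Proof.
move=> st Xg; have [h0 gh0] := refinement_exists st Xg.
have len0 : 0 < h0.2 - h0.1 by case: gh0 => -[]; lra.
pose long := [set h | refinement t g h /\ h0.2 - h0.1 <= h.2 - h.1].
pose rank (h : F * F) : F *lexi[ring_display] F := (h.1 - h.2, h.1).
have [||h [gh h0h] hmin] := @finite_set_argmin _ _ _ long rank.
- by apply: sub_finite_set (long_gaps_finite (X_itv (t := t)) len0) => h [[]].
- by exists h0; split=> /=.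
exists h; split=> // k gk.
have [h0k|] := leP (h0.2 - h0.1) (k.2 - k.1); last first.
  by move=> kh0; left; exact: lt_le_trans h0h.
have := hmin k (conj gk h0k); rewrite lexi_pair /= => /andP[].
rewrite le_eqVlt => /predU1P[hk /implyP hk1|hk _]; last by left; lra.
by right; split; [lra | apply: hk1; rewrite hk].
Qed.

Lemma next_gap_unique t g h k : next_gap t g h -> next_gap t g k -> h = k.
Proof.
move=> [gh hmin] [gk kmin]; rewrite [h]surjective_pairing [k]surjective_pairing.
by have [?|[? ?]] := hmin _ gk; have [?|[? ?]] := kmin _ gh; congr pair; lra.
Qed.

Definition follows (D : set F) (g0 : F * F) s x :=
  g0.1 < x < g0.2 /\ forall e e' g h, successor_in D e e' -> e' <= s ->
    gap (X e) g -> gap (X e') h -> g.1 < x < g.2 -> h.1 < x < h.2 ->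
    next_gap e' g h.

Lemma definable_followed_left_ends D g0 : definable1 S D ->
  definable1 S [set a | exists s x b,
    [/\ D s, gap (X s) (a, b), a < x < b & follows D g0 s x]].
Proof.
move=> D_definable.
rewrite /follows /successor_in /next_gap /precedes /refinement.
rewrite /hits /older /gap.
by definability.
Qed.

Section Path.

Variable lev : nat -> F.
Hypothesis lev_mono : {mono lev : m n / (m <= n)%N >-> m <= n}.

Variable g0 : F * F.
Hypothesis g0_gap : gap (X (lev 0%N)) g0.

Fixpoint path n : F * F :=
  if n is m.+1 then xget g0 (next_gap (lev n) (path m)) else g0.

Let level_le m n : (m <= n)%N -> lev m <= lev n.
Proof. by rewrite lev_mono. Qed.

Lemma path_gap n : gap (X (lev n)) (path n).
Proof.
elim: n => [//|n IHn] /=; have [h] := next_gap_exists (level_le (leqnSn n)) IHn.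
by move=> /(xgetI g0) [[]].
Qed.

Lemma path_next n : next_gap (lev n.+1) (path n) (path n.+1).
Proof.
have [h] := next_gap_exists (level_le (leqnSn n)) (path_gap n).
exact: xgetI.
Qed.

Lemma path_nested m n : (m <= n)%N ->
  (path m).1 <= (path n).1 /\ (path n).2 <= (path m).2.
Proof.
move=> /subnK <-; elim: (n - m)%N => [//|k [IH1 IH2]]; rewrite addSn.
have [[_ ? ? _] _] := path_next (k + m).
by split; [exact: le_trans IH1 _ | exact: le_trans IH2].
Qed.

Lemma path_inside m n x : (m <= n)%N ->
  (path n).1 < x < (path n).2 -> (path m).1 < x < (path m).2.
Proof. by move=> /path_nested; lra. Qed.

Lemma path_ends_lt m n : (path m).1 < (path n).2.
Proof.
have [mk _] := path_nested (leq_maxl m n).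
have [_ nk] := path_nested (leq_maxr m n).
by have [_ _ ? _] := path_gap (maxn m n); lra.
Qed.

Lemma follows_path n x g : follows (range lev) g0 (lev n) x ->
  gap (X (lev n)) g -> g.1 < x < g.2 -> g = path n.
Proof.
move=> [g0x xfollows] Xg gx.
suff path_x k : (k <= n)%N -> (path k).1 < x < (path k).2.
  exact: gap_inj Xg (path_gap n) gx (path_x n (leqnn n)).
elim: k => [//|k IHk] kn; have kx := IHk (ltnW kn).
have nXx : ~ X (lev k.+1) x.
  by move=> /(X_incr (level_le kn)); case: Xg => _ _ _; apply.
have x01 := gap_sub_itv (X_itv (t := lev n)) Xg gx.
have [|||h Xh hx] := gap_around S_complete _ (X_closed (t := lev k.+1)) _ _ nXx.
- exact: definable_family_section.
- by exists 0 => //; lra.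
- by exists 1 => //; lra.
rewrite (next_gap_unique (path_next k) (k := h)) //.
apply: (xfollows (lev k)) => //; last exact: path_gap; last exact: level_le.
by apply/successor_in_range => //; exists k.
Qed.

Lemma path_follows n x :
  (path n).1 < x < (path n).2 -> follows (range lev) g0 (lev n) x.
Proof.
move=> nx; split; first exact: path_inside (leq0n n) nx.
move=> e e' g h /(successor_in_range lev_mono)[k -> ->].
rewrite lev_mono => kn Xg Xh gx hx.
rewrite (gap_inj Xg (path_gap k) gx (path_inside (ltnW kn) nx)).
rewrite (gap_inj Xh (path_gap k.+1) hx (path_inside kn nx)).
exact: path_next.
Qed.

Lemma definable_path_left_ends : definable1 S (range lev) ->
  definable1 S (range (fun n => (path n).1)).
Proof.
move=> /(definable_followed_left_ends g0); congr definable1.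
apply/seteqP; split.
- move=> a [s [x [b [[n _ <-] Xab abx x_follows]]]]; exists n => //.
  by rewrite -(follows_path x_follows Xab abx).
- move=> _ [n _ <-]; exists (lev n), (midpoint (path n)), (path n).2.
  have n_mid := gap_midpoint (path_gap n).
  by split=> //; [exact: path_gap | exact: path_follows].
Qed.

Hypothesis lev_cofinal : cofinal (range lev).
Hypothesis X_cover : forall x : F, 0 <= x <= 1 -> exists t, X t x.

Lemma level_cover x : 0 <= x <= 1 -> exists n, X (lev n) x.
Proof.
move=> /X_cover[t Xtx]; have [_ [n _ <-] /ltW tn] := lev_cofinal t.
by exists n; exact: X_incr Xtx.
Qed.

Lemma path_hit n : exists2 m, path m = path n & hits (lev m.+1) (path m).
Proof.
have Xn := path_gap n.
have [k Xk] := level_cover (gap_sub_itv (X_itv (t := _)) Xn (gap_midpoint Xn)).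
pose hit_after m := (n <= m)%N && `[<hits (lev m.+1) (path n)>].
have exists_hit : exists m, hit_after m.
  exists (maxn n k); rewrite /hit_after leq_maxl; apply/asboolP.
  exists (midpoint (path n)); split; last exact: gap_midpoint Xn.
  by apply: X_incr Xk; apply: level_le; exact/leqW/leq_maxr.
case: (ex_minnP exists_hit) => m /andP[nm /asboolP hit_m] m_min.
suff stays j : (n <= j)%N -> (j <= m)%N -> path j = path n.
  by exists m; rewrite stays.
move=> /subnK <-; elim: (j - n)%N => [//|i IHi]; rewrite addSn => im.
have path_i := IHi (ltnW im); have [refines _] := path_next (i + n).
rewrite -path_i; apply: refinement_unhit refines; rewrite path_i => hit_i.
suff : hit_after (i + n)%N by move=> /m_min; rewrite leqNgt im.
by rewrite /hit_after leq_addl; exact/asboolP.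
Qed.

Lemma path_shrinks n :
  exists m, (path n).1 < (path m).1 /\ (path m).2 < (path n).2.
Proof.
have [m <- hit_m] := path_hit n; have [k path_k hit_k] := path_hit m.+1.
have [refines_m _] := path_next m; have [refines_k _] := path_next k.
rewrite path_k in hit_k refines_k; exists k.+1.
exact: refinement_twice (path_gap m) hit_m refines_m hit_k refines_k.
Qed.

Lemma no_definable_levels : ~ definable1 S (range lev).
Proof.
move=> /definable_path_left_ends left_definable.
have [||c [left_c c_left]] := definable1_supremums S_complete left_definable.
- by exists g0.1, 0%N.
- by exists g0.2 => _ [n _ <-]; exact/ltW/(path_ends_lt n 0).
have c_path n : (path n).1 < c < (path n).2.
  have [m [left_m right_m]] := path_shrinks n; apply/andP; split.
    by apply: lt_le_trans left_m _; apply: left_c; exists m.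
  apply: le_lt_trans right_m; apply: c_left => _ [k _ <-].
    exact/ltW/path_ends_lt.
have [n Xc] := level_cover (gap_sub_itv (X_itv (t := _)) g0_gap (c_path 0%N)).
by have [_ _ _ /(_ c (c_path n))] := path_gap n.
Qed.

End Path.

Lemma filtration_not_cover : exists2 x : F, 0 <= x <= 1 & forall t, ~ X t x.
Proof.
apply: contrapT => no_x.
have X_cover (x : F) : 0 <= x <= 1 -> exists t, X t x.
  move=> x01; apply: contrapT => nXx; apply: no_x; exists x => // t Xx.
  by apply: nXx; exists t.
have [D [D_definable D_finite D_cofinal]] := exists_definable_levels X_cover.
have [lev levD lev_mono] := cofinal_enum (0 : F) D_finite D_cofinal.
rewrite -levD in D_definable D_cofinal.
have [g0 Xg0 _] := level_gap_between (X_0 (lev 0%N)) (X_1 (lev 0%N)) ltr01.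
exact: (no_definable_levels lev_mono Xg0 D_cofinal X_cover D_definable).
Qed.

End Filtrations.

(* Adding 0 and 1 makes every component of the complement in [0, 1] a gap. *)
Definition closure01 (F : realFieldType) (A : set (order_topology F)) :
    set (order_topology F) :=
  [set 0; 1] `|` (closure A `&` `[0, 1]).

Section Closure01.

Variable F : realFieldType.
Implicit Types A B : set (order_topology F).

Lemma closure01_itv A (x : F) : closure01 A x -> 0 <= x <= 1.
Proof. by move=> [[->|->]|[_]]; rewrite ?lexx ?ler01 //= in_itv. Qed.

Lemma sub_closure01 A (x : F) : 0 <= x <= 1 -> A x -> closure01 A x.
Proof.
by move=> x01 Ax; right; split; [exact: subset_closure | rewrite /= in_itv].
Qed.

Lemma closure01S A B : A `<=` B -> closure01 A `<=` closure01 B.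
Proof. by move=> /closureS clAB; apply: setUS; exact: setSI. Qed.

Lemma closed_closure01 A : closed (closure01 A).
Proof.
apply: closedU; first by apply: closedU; exact: closed_order_set1.
by apply: closedI; [exact: closed_closure | exact: itv_closed].
Qed.

Lemma nowhere_dense_closure01 A :
  nowhere_dense A -> nowhere_dense (closure01 A).
Proof.
move=> A0; apply: nowhere_denseU.
  by apply: nowhere_denseU; exact: nowhere_dense_set1.
apply: nowhere_denseS (@subIsetl _ _ _) _.
by rewrite /nowhere_dense -(closure_id _).1 //; exact: closed_closure.
Qed.

End Closure01.

Lemma definable_closure01 (F : realFieldType) (L : language) (T : structure L F)
    (Y : set (F * F)) :
  definable2 (expansion (ofield_structure F) T) Y ->
  definable_family (expansion (ofield_structure F) T)
    (fun t => closure01 (ysection Y t : set (order_topology F))).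
Proof.
move=> Y_definable; rewrite (_ : (fun t => _) = fun t : F => [set x : F |
    (x = 0 \/ x = 1) \/ (forall u v : F, u < x < v ->
      exists y, Y (y, t) /\ u < y < v) /\ 0 <= x <= 1]).
  by definability.
apply/funext => t; congr (_ `|` (_ `&` _)); apply/seteqP; split=> x.
- move=> /closure_orderP clYx u v /clYx[y]; rewrite /ysection /= inE => Yy uyv.
  by exists y.
- move=> Yx; apply/closure_orderP => u v /Yx[y [Yy uyv]].
  by exists y => //; rewrite /ysection /= inE.
Qed.

Lemma definably_Baire_archimedean (F : archiRealFieldType) (L : language)
    (T : structure L F) :
  definably_complete (expansion (ofield_structure F) T) ->
  definably_Baire (expansion (ofield_structure F) T).
Proof.
move=> S_complete [Y [Y_definable Y_pos Y_nd Y_incr Y_cover]].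
have Y_le0 t : t <= 0 -> ysection Y t = set0.
  move=> t0; rewrite -subset0 => x; rewrite /ysection /= inE => /Y_pos /=.
  by rewrite ltNge t0.
have Y_nowhere_dense t : nowhere_dense (ysection Y t : set (order_topology F)).
  have [/Y_nd //|/Y_le0->] := ltP 0 t.
  by rewrite /nowhere_dense closure0 interior0.
have Y_mono s t : s <= t -> ysection Y s `<=` ysection Y t.
  rewrite le_eqVlt => /predU1P[->//|st].
  have [s0|/Y_le0->//] := ltP 0 s; exact: Y_incr s0 (lt_trans s0 st) st.
pose X t := closure01 (ysection Y t).
have [|||||||x x01 nXx] := @filtration_not_cover F L T S_complete X.
- exact: definable_closure01.
- by move=> t; exact: closed_closure01.
- by move=> t; exact: nowhere_dense_closure01.
- by move=> t x; exact: closure01_itv.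
- by move=> t; left; left.
- by move=> t; left; right.
- by move=> s t /Y_mono; exact: closure01S.
have : [set: F] x by []; rewrite -Y_cover => -[t _ Yxt].
by apply: (nXx t); exact: sub_closure01.
Qed.

Lemma subfield_archimedean (R : realType) (K : divringClosed R) :
  Num.archimedean_axiom (subfield_of K).
Proof.
move=> x; exists (Num.bound (val `|x|)).
by rewrite sf_ltE (rmorph_nat val) archi_boundP //; exact: normr_ge0.
Qed.

HB.instance Definition _ (R : realType) (K : divringClosed R) :=
  Num.NumDomain_bounded_isArchimedean.Build (subfield_of K)
    (@subfield_archimedean R K).

Theorem theoremD (R : realType) (K : divringClosed R) (L : language)
    (S : structure L (subfield_of K)) :
  definably_complete (expansion (ofield_structure (subfield_of K)) S) ->
  definably_Baire (expansion (ofield_structure (subfield_of K)) S).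
Proof. exact: definably_Baire_archimedean. Qed.
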